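(* Let $n,r,s\geq 1$ be integers, $d=\gcd(r,n,s)$, $R=r/d$, $N=n/d$, $S=s/d$. (a) If $s\neq r$ then $H(r,n,s)^{\mathrm{ab}}\cong A_0\oplus\mathbb{Z}^{d-1}$ where $A_0$ is a finite abelian group of order $|H(R,N,S)^{\mathrm{ab}}|^d/|S-R|^{d-1}$. (b) If $s=r$ then $H(r,n,s)^{\mathrm{ab}}\cong A_0\oplus\mathbb{Z}^{d}$ where $A_0$ is a finite abelian group of order $N^{d-1}$.
   Context: For integers $n,r,s\geq 1$, the generalized Fibonacci group $H(r,n,s)$ is the group with presentation \[H(r,n,s)=\left\langle x_0,\ldots,x_{n-1}\ \middle|\ \prod_{j=0}^{r-1}x_{i+j}=\prod_{j=0}^{s-1}x_{i+j+r}\ (0\leq i<n)\right\rangle,\] where subscripts are taken modulo $n$ and products are taken in order of increasing $j$. $G^{\mathrm{ab}}$ denotes the abelianisation of $G$. *)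

(* Defs.v *)
From HB Require Import structures.
From mathcomp Require Import all_boot all_order all_algebra.
From mathcomp Require Import boolp classical_sets functions cardinality.

Set Implicit Arguments.
Unset Strict Implicit.
Unset Printing Implicit Defensive.

(* Words in the letters x and x^-1 (x : X): (x, true) stands for x and
   (x, false) for x^-1. *)
Definition word (X : Type) : Type := seq (X * bool).

Definition inv_letter X (l : X * bool) : X * bool := (l.1, ~~ l.2).

Definition inv_word X (w : word X) : word X := rev (map (@inv_letter X) w).

(* The congruence on words whose quotient is the group
   < X | u = v for all u, v with rels u v >. *)
Inductive pres_eq X (rels : word X -> word X -> Prop) :
    word X -> word X -> Prop :=
| pres_eq_refl w : pres_eq rels w w
| pres_eq_sym u v : pres_eq rels u v -> pres_eq rels v u
| pres_eq_trans v u w :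
    pres_eq rels u v -> pres_eq rels v w -> pres_eq rels u w
| pres_eq_cat u u' v v' :
    pres_eq rels u u' -> pres_eq rels v v' -> pres_eq rels (u ++ v) (u' ++ v')
| pres_eq_cancel l : pres_eq rels [:: l; inv_letter l] [::]
| pres_eq_rel u v : rels u v -> pres_eq rels u v.

Section PresentedGroup.
Variables (X : choiceType) (rels : word X -> word X -> Prop).

Lemma pres_eqV w : pres_eq rels (w ++ inv_word w) [::].
Proof.
elim: w => [|l w IHw]; first exact: pres_eq_refl.
rewrite /inv_word map_cons rev_cons -cats1 -/(inv_word w).
have -> : (l :: w) ++ inv_word w ++ [:: inv_letter l]
    = [:: l] ++ ((w ++ inv_word w) ++ [:: inv_letter l]) by rewrite /= -catA.
apply: pres_eq_trans (pres_eq_cancel rels l).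
rewrite -[X in pres_eq _ _ X]/([:: l] ++ ([::] ++ [:: inv_letter l])).
by do 2?[apply: pres_eq_cat => //]; exact: pres_eq_refl.
Qed.

Lemma inv_wordK : involutive (@inv_word X).
Proof.
move=> w; rewrite /inv_word map_rev revK -map_comp -[RHS]map_id.
by apply: eq_map => -[x b]; rewrite /inv_letter /= negbK.
Qed.

Lemma pres_eqVl w : pres_eq rels (inv_word w ++ w) [::].
Proof. by rewrite -{2}[w]inv_wordK; exact: pres_eqV. Qed.

Lemma pres_eq_inv u v :
  pres_eq rels u v -> pres_eq rels (inv_word u) (inv_word v).
Proof.
move=> uv; apply: (@pres_eq_trans _ _ (inv_word u ++ (v ++ inv_word v))).
  rewrite -{1}[inv_word u]cats0; apply: pres_eq_cat; first exact: pres_eq_refl.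
  exact/pres_eq_sym/pres_eqV.
apply: (@pres_eq_trans _ _ ((inv_word u ++ u) ++ inv_word v)).
  rewrite -catA; apply: pres_eq_cat; first exact: pres_eq_refl.
  by apply: pres_eq_cat; [exact: pres_eq_sym | exact: pres_eq_refl].
rewrite -[X in pres_eq _ _ X]cat0s.
by apply: pres_eq_cat; [exact: pres_eqVl | exact: pres_eq_refl].
Qed.

Definition pres_rel : rel (word X) := fun u v => `[< pres_eq rels u v >].

Lemma pres_rel_refl : reflexive pres_rel.
Proof. by move=> u; apply/asboolP; exact: pres_eq_refl. Qed.

Lemma pres_rel_sym : symmetric pres_rel.
Proof.
by move=> u v; apply/asboolP/asboolP => uv; exact: pres_eq_sym.
Qed.

Lemma pres_rel_trans : transitive pres_rel.
Proof.
move=> v u w /asboolP uv /asboolP vw; apply/asboolP.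
exact: pres_eq_trans uv vw.
Qed.

Canonical pres_equiv :=
  EquivRel pres_rel pres_rel_refl pres_rel_sym pres_rel_trans.

Definition presented : Type := {eq_quot pres_equiv}%qT.

HB.instance Definition _ := Choice.on presented.
HB.instance Definition _ := EqQuotient.on presented.

Definition word_class (w : word X) : presented := \pi_presented%qT w.

Lemma word_classP u v : word_class u = word_class v <-> pres_eq rels u v.
Proof.
split=> [/eqmodP/asboolP //|uv].
by apply/eqmodP/asboolP.
Qed.

Lemma word_class_repr (x : presented) : word_class (repr x) = x.
Proof. exact: reprK. Qed.

Lemma repr_word_class w : pres_eq rels (repr (word_class w)) w.
Proof. by apply/word_classP; exact: word_class_repr. Qed.

Definition presented_mul (x y : presented) : presented :=
  word_class (repr x ++ repr y).
Definition presented_one : presented := word_class [::].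
Definition presented_inv (x : presented) : presented :=
  word_class (inv_word (repr x)).

Lemma presented_mulE u v :
  presented_mul (word_class u) (word_class v) = word_class (u ++ v).
Proof. by apply/word_classP/pres_eq_cat; exact: repr_word_class. Qed.

Lemma presented_invE u :
  presented_inv (word_class u) = word_class (inv_word u).
Proof. by apply/word_classP/pres_eq_inv/repr_word_class. Qed.

Lemma presented_mulA : associative presented_mul.
Proof.
move=> x y z; rewrite -(word_class_repr x) -(word_class_repr y).
by rewrite -(word_class_repr z) !presented_mulE catA.
Qed.

Lemma presented_mul1 : left_id presented_one presented_mul.
Proof. by move=> x; rewrite -(word_class_repr x) presented_mulE. Qed.

Lemma presented_mulr1 : right_id presented_one presented_mul.
Proof. by move=> x; rewrite -(word_class_repr x) presented_mulE cats0. Qed.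

Lemma presented_mulV : left_inverse presented_one presented_inv presented_mul.
Proof.
move=> x; rewrite -(word_class_repr x) presented_invE presented_mulE.
by apply/word_classP; exact: pres_eqVl.
Qed.

Lemma presented_mulrV :
  right_inverse presented_one presented_inv presented_mul.
Proof.
move=> x; rewrite -(word_class_repr x) presented_invE presented_mulE.
by apply/word_classP; exact: pres_eqV.
Qed.

HB.instance Definition _ := isGroup.Build presented
  presented_mulA presented_mul1 presented_mulr1 presented_mulV presented_mulrV.

End PresentedGroup.

Local Open Scope group_scope.

(* The commutator subgroup [G, G]. *)
Inductive derived (G : groupType) : G -> Prop :=
| derived_comm x y : derived [~ x, y]
| derived_one : derived 1
| derived_mul x y : derived x -> derived y -> derived (x * y)
| derived_inv x : derived x -> derived x^-1.

Section Abelianization.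
Variable G : groupType.
Implicit Types x y z : G.

Lemma derivedJ x y : derived x -> derived (x ^ y).
Proof.
move=> dx; have -> : x ^ y = x * [~ x, y] by rewrite commgEl mulVKg.
by apply: derived_mul => //; exact: derived_comm.
Qed.

Definition ab_rel : rel G := fun x y => `[< derived (x^-1 * y) >].

Lemma ab_rel_refl : reflexive ab_rel.
Proof. by move=> x; apply/asboolP; rewrite mulVg; exact: derived_one. Qed.

Lemma ab_rel_sym : symmetric ab_rel.
Proof.
move=> x y; apply/asboolP/asboolP => /derived_inv; by rewrite invgM invgK.
Qed.

Lemma ab_rel_trans : transitive ab_rel.
Proof.
move=> y x z /asboolP xy /asboolP yz; apply/asboolP.
by have := derived_mul xy yz; rewrite -mulgA mulVKg.
Qed.

Canonical ab_equiv := EquivRel ab_rel ab_rel_refl ab_rel_sym ab_rel_trans.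

(* G / [G, G], written additively. *)
Definition abelianization : Type := {eq_quot ab_equiv}%qT.

HB.instance Definition _ := Choice.on abelianization.
HB.instance Definition _ := EqQuotient.on abelianization.

Definition ab_class x : abelianization := \pi_abelianization%qT x.

Lemma ab_classP x y : ab_class x = ab_class y <-> derived (x^-1 * y).
Proof.
split=> [/eqmodP/asboolP //|xy].
by apply/eqmodP/asboolP.
Qed.

Lemma ab_class_repr (a : abelianization) : ab_class (repr a) = a.
Proof. exact: reprK. Qed.

Lemma derived_repr x : derived ((repr (ab_class x))^-1 * x).
Proof. by apply/ab_classP; exact: ab_class_repr. Qed.

Definition ab_add (a b : abelianization) : abelianization :=
  ab_class (repr a * repr b).
Definition ab_zero : abelianization := ab_class 1.
Definition ab_opp (a : abelianization) : abelianization :=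
  ab_class (repr a)^-1.

Lemma ab_addE x y : ab_add (ab_class x) (ab_class y) = ab_class (x * y).
Proof.
apply/ab_classP; set x' := repr _; set y' := repr _.
have -> : (x' * y')^-1 * (x * y) = (x'^-1 * x) ^ y' * (y'^-1 * y).
  by rewrite /conjg invgM !mulgA mulgK.
by apply: derived_mul; [apply: derivedJ|]; exact: derived_repr.
Qed.

Lemma ab_oppE x : ab_opp (ab_class x) = ab_class x^-1.
Proof.
apply/ab_classP; set x' := repr _; rewrite invgK.
have -> : x' * x^-1 = ((x'^-1 * x)^-1) ^ x'^-1.
  by rewrite /conjg invgM !invgK !mulgA mulgK.
by apply/derivedJ/derived_inv/derived_repr.
Qed.

Lemma ab_addA : associative ab_add.
Proof.
move=> a b c; rewrite -(ab_class_repr a) -(ab_class_repr b).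
by rewrite -(ab_class_repr c) !ab_addE mulgA.
Qed.

Lemma ab_addC : commutative ab_add.
Proof.
move=> a b; rewrite -(ab_class_repr a) -(ab_class_repr b) !ab_addE.
apply/ab_classP; have -> z t : (z * t)^-1 * (t * z) = [~ t, z].
  by rewrite /commg /conjg invgM !mulgA.
exact: derived_comm.
Qed.

Lemma ab_add0 : left_id ab_zero ab_add.
Proof. by move=> a; rewrite -(ab_class_repr a) ab_addE mul1g. Qed.

Lemma ab_addN : left_inverse ab_zero ab_opp ab_add.
Proof. by move=> a; rewrite -(ab_class_repr a) ab_oppE ab_addE mulVg. Qed.

HB.instance Definition _ :=
  GRing.isZmodule.Build abelianization ab_addA ab_addC ab_add0 ab_addN.

End Abelianization.

Local Close Scope group_scope.

(* The index i + k modulo n. *)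
Definition shift_idx n (i : 'I_n) (k : nat) : 'I_n :=
  Ordinal (ltn_pmod (i + k) (leq_ltn_trans (leq0n i) (ltn_ord i))).

(* x_i x_(i+1) ... x_(i+r-1) = x_(i+r) x_(i+r+1) ... x_(i+r+s-1), 0 <= i < n *)
Definition fib_rels (r n s : nat) (u v : word 'I_n) : Prop :=
  exists i : 'I_n,
    u = [seq (shift_idx i j, true) | j <- iota 0 r] /\
    v = [seq (shift_idx i (j + r), true) | j <- iota 0 s].

(* The group H(r, n, s). *)
Definition fib_group (r n s : nat) : groupType := presented (@fib_rels r n s).

(* Main.v *)
(* H(r,n,s)^ab is Z[x]/(f, x^n - 1), where f = f_(r,s) is the polynomial of the
   relator x_0 ... x_(r-1) = x_r ... x_(r+s-1), and f(x) = F(x^d) Phi(x) with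
   F = f_(R,S) and Phi = 1 + ... + x^(d-1). Write p = sum_(i < d) x^i p_i(x^d).
   Since (x - 1) Phi = x^d - 1, in the coordinates p_(d-1) and p_i - p_(d-1)
   (i < d - 1) the ideal (f, x^n - 1) becomes (F, y^N - 1) in the first one and
   ((y - 1) F, y^N - 1) in each of the others. Splitting off the value at y = 1,
   the quotient by the latter is T (+) Z, where T = Z[y]/(F, 1 + ... + y^(N-1)).
   Hence H(r,n,s)^ab = B (+) T^(d-1) (+) Z^(d-1) with B = H(R,N,S)^ab.
   If R <> S, then F has no root among the N-th roots of unity, so B is finite,
   and 1 + ... + y^(N-1) generates a subgroup of B of order |R - S| with
   quotient T. If R = S, then (F, y^N - 1) = (y - 1), so B = Z and T = Z/N. *)
Require Import Defs.
From HB Require Import structures.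
From mathcomp Require Import all_boot all_order all_algebra.
From mathcomp Require Import algC ring zify.
From mathcomp Require Import boolp classical_sets functions cardinality.

Set Implicit Arguments.
Unset Strict Implicit.
Unset Printing Implicit Defensive.

Import GRing.Theory Num.Theory.
Local Open Scope quotient_scope.
Local Open Scope ring_scope.

(** * Quotients of abelian groups, described by surjections with prescribed kernel *)

Definition surjection_with_kernel (V G : zmodType) (K : V -> Prop)
    (f : {additive V -> G}) : Prop :=
  (forall y, exists x, f x = y) /\ (forall x, f x = 0 <-> K x).

Lemma additive_exists (U V : zmodType) (f : U -> V) :
  {morph f : x y / x - y} -> exists g : {additive U -> V}, g =1 f.
Proof.
move=> fB; pose m := GRing.isZmodMorphism.Build U V f fB.
by exists (HB.pack f m : {additive U -> V}).
Qed.

(** [h] is [g] after a set-theoretic section of [f]. As both kernels are [K], the values of [f] and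
    [g] determine each other, so [h] is additive and [f] after a section of [g] inverts it. *)
Lemma first_isomorphism (V G H : zmodType) (K : V -> Prop)
    (f : {additive V -> G}) (g : {additive V -> H}) :
    surjection_with_kernel K f -> surjection_with_kernel K g ->
  exists h : {additive G -> H}, bijective h.
Proof.
move=> [fS fK] [gS gK].
have [s sK] := choice fS; have [t tK] := choice gS.
have fg x y : f x = f y -> g x = g y.
  by move/eqP; rewrite -subr_eq0 -raddfB => /eqP/fK/gK/eqP;
    rewrite raddfB subr_eq0 => /eqP.
have gf x y : g x = g y -> f x = f y.
  by move/eqP; rewrite -subr_eq0 -raddfB => /eqP/gK/fK/eqP;
    rewrite raddfB subr_eq0 => /eqP.
have [|h hE] := @additive_exists G H (g \o s).
  by move=> x y /=; rewrite -raddfB; apply: fg; rewrite raddfB !sK.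
exists h; exists (f \o t) => x; first by rewrite hE -[RHS]sK; apply: gf; rewrite tK.
by rewrite hE -[RHS]tK; apply: fg; rewrite sK.
Qed.

Section CoveredZmodule.
Variables (G : zmodType) (s : seq G) (s_full : forall x, x \in s).

(* G under a name that can carry the finite structure given by s_full. *)
Definition covered (_ : forall x, x \in s) : Type := G.

HB.instance Definition _ := GRing.Zmodule.on (covered s_full).

Lemma covered_indexK :
  pcancel (fun x : covered s_full => index (x : G) s) (fun i => ohead (drop i s)).
Proof. by move=> x; rewrite (drop_nth 0) ?index_mem//= nth_index. Qed.

HB.instance Definition _ := PCanIsCountable covered_indexK.

Lemma covered_enumP : @Finite.axiom (covered s_full) (undup s).
Proof.
by move=> x; rewrite count_uniq_mem ?undup_uniq// mem_undup s_full.
Qed.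

HB.instance Definition _ := isFinite.Build (covered s_full) covered_enumP.

End CoveredZmodule.

Section Quotient.
Variables (V : zmodType) (K : V -> Prop).
Hypotheses (K0 : K 0) (KB : forall x y, K x -> K y -> K (x - y)).

Definition in_subgroup : {pred V} := fun x => `[< K x >].

Fact in_subgroup_zmod_closed : zmod_closed in_subgroup.
Proof.
by split=> [|x y /asboolP Kx /asboolP Ky]; apply/asboolP; [|exact: KB].
Qed.

HB.instance Definition _ :=
  GRing.isZmodClosed.Build V in_subgroup in_subgroup_zmod_closed.

(** The list only has to meet every coset; repetitions disappear when [covered] enumerates the
    quotient. *)
Lemma finite_quotient (s : seq V) :
    (forall x, exists2 y, y \in s & K (x - y)) ->
  exists (A : finZmodType) (f : {additive V -> A}),
    surjection_with_kernel K f.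
Proof.
move=> s_full; pose Q := @Quotient.quot V in_subgroup : zmodType.
have piP (x y : V) : (\pi_Q x = \pi_Q y) <-> K (x - y).
  have := @Quotient.idealrBE V in_subgroup x y; rewrite unfold_in => xyE.
  split=> [/eqP|/asboolP Kxy]; first by rewrite -xyE => /asboolP.
  by apply/eqP; rewrite -xyE.
have full (q : Q) : q \in [seq \pi_Q x | x <- s].
  have [x xs Kx] := s_full (repr q).
  by rewrite -[q]reprK; apply/mapP; exists x => //; apply/piP.
exists (covered full).
have [f fE] := @additive_exists V (covered full) (fun x => \pi_Q x) (raddfB _).
exists f; split => [y|x]; first by exists (repr (y : Q)); rewrite fE; exact: reprK.
rewrite fE -[K x](congr1 K (subr0 x)); rewrite -piP.
by rewrite [X in _ <-> _ = X](raddf0 (\pi_Q)).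
Qed.

End Quotient.

(** * Additive maps out of Z[x] *)

Lemma poly_int_additiveE (G : zmodType) (f : {additive {poly int} -> G})
    (p : {poly int}) m :
  (size p <= m)%N -> f p = \sum_(i < m) f 'X^i *~ p`_i.
Proof.
move=> sz_p; rewrite -[in LHS](coefK p) (@poly_def _ (size p)) raddf_sum.
rewrite (big_ord_widen _ (fun i => f (p`_i *: 'X^i)) sz_p) big_mkcond /=.
apply: eq_bigr => i _; case: ltnP => [_|/(nth_default 0)->]; last by rewrite mulr0z.
by rewrite -raddfMz -scaler_int intz.
Qed.

Lemma eq_poly_int_additive (G : zmodType) (f g : {additive {poly int} -> G}) :
  (forall i, f 'X^i = g 'X^i) -> f =1 g.
Proof.
move=> fg p; rewrite !(@poly_int_additiveE _ _ p (size p))//.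
by apply: eq_bigr => i _; rewrite fg.
Qed.

(** Z[x] is free abelian on the powers of ['X]. *)
Lemma poly_int_additive_exists (G : zmodType) (g : nat -> G) :
  exists f : {additive {poly int} -> G}, forall i, f 'X^i = g i.
Proof.
pose h (p : {poly int}) := \sum_(i < size p) g i *~ p`_i.
(* A common bound [m] lets the sums for [p], [q] and [p - q] run over the same range. *)
have hE (p : {poly int}) m : (size p <= m)%N -> h p = \sum_(i < m) g i *~ p`_i.
  move=> sz_p; rewrite /h (big_ord_widen _ (fun i => g i *~ p`_i) sz_p) big_mkcond.
  by apply: eq_bigr => i _; case: ltnP => // /(nth_default 0)->; rewrite mulr0z.
have [|f fE] := @additive_exists _ _ h.
  move=> p q; pose m := maxn (size p) (size q).
  have sz_pq : (size (p - q)%R <= m)%N.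
    by rewrite (leq_trans (size_polyD _ _))// size_polyN.
  rewrite (hE _ m)// (hE p m) ?leq_maxl// (hE q m) ?leq_maxr// -sumrB.
  by apply: eq_bigr => i _; rewrite coefB mulrzBr.
exists f => i; rewrite fE (hE _ i.+1) ?size_polyXn// big_ord_recr /= coefXn eqxx.
rewrite big1 ?add0r // => j _.
by rewrite coefXn (ltn_eqF (ltn_ord j)) mulr0z.
Qed.

(** * Ideals of Z[x] with two generators *)

Definition in_ideal (a b p : {poly int}) : Prop := exists u v, p = u * a + v * b.

Section InIdeal.
Variables a b : {poly int}.
Implicit Types p q : {poly int}.

Lemma in_ideal0 : in_ideal a b 0.
Proof. by exists 0, 0; rewrite !mul0r addr0. Qed.

Lemma in_idealB p q : in_ideal a b p -> in_ideal a b q -> in_ideal a b (p - q).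
Proof.
move=> [u [v ->]] [u' [v' ->]]; exists (u - u'), (v - v').
by rewrite !mulrBl opprD addrACA.
Qed.

Lemma in_idealN p : in_ideal a b p -> in_ideal a b (- p).
Proof. by move=> Ip; rewrite -sub0r; apply: in_idealB => //; exact: in_ideal0. Qed.

Lemma in_idealD p q : in_ideal a b p -> in_ideal a b q -> in_ideal a b (p + q).
Proof.
by move=> Ip Iq; rewrite -[q]opprK; apply: in_idealB => //; exact: in_idealN.
Qed.

Lemma in_idealMl p q : in_ideal a b p -> in_ideal a b (q * p).
Proof. by move=> [u [v ->]]; exists (q * u), (q * v); rewrite mulrDr !mulrA. Qed.

Lemma in_ideal_l : in_ideal a b a.
Proof. by exists 1, 0; rewrite mul1r mul0r addr0. Qed.

Lemma in_ideal_r : in_ideal a b b.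
Proof. by exists 0, 1; rewrite mul1r mul0r add0r. Qed.

Lemma in_ideal_sum (I : Type) (t : seq I) (F : I -> {poly int}) :
  (forall i, in_ideal a b (F i)) -> in_ideal a b (\sum_(i <- t) F i).
Proof.
by move=> IF; apply: big_ind => //; [exact: in_ideal0 | exact: in_idealD].
Qed.

End InIdeal.

(** * The abelianisation as a quotient of Z[x] *)

Definition fib_poly (r s : nat) : {poly int} :=
  \sum_(0 <= j < r) 'X^j - \sum_(0 <= j < s) 'X^(j + r).

Section FibAbelianization.
Variables (r n s : nat).
Hypothesis n_gt0 : (0 < n)%N.

Let rels := @fib_rels r n s.
Let I := in_ideal (fib_poly r s) ('X^n - 1).

Definition ab_word (w : word 'I_n) : abelianization (fib_group r n s) :=
  @ab_class (fib_group r n s) (word_class rels w).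

(** The exponent sums of a word, that of x_i being the coefficient of ['X^i]. *)
Definition exponents (w : word 'I_n) : {poly int} :=
  \sum_(l <- w) (if l.2 then 'X^(l.1) else - 'X^(l.1)).

Lemma ab_word_cat u v : ab_word (u ++ v) = ab_word u + ab_word v.
Proof.
rewrite /ab_word -presented_mulE.
symmetry; exact: (@ab_addE (fib_group r n s)).
Qed.

Lemma ab_word_nil : ab_word [::] = 0. Proof. by []. Qed.

Lemma ab_word_cancel i : ab_word [:: (i, false)] = - ab_word [:: (i, true)].
Proof.
apply/eqP; rewrite -addr_eq0 -ab_word_cat -ab_word_nil; apply/eqP.
by congr (ab_class _); apply/word_classP; exact: (pres_eq_cancel _ (i, false)).
Qed.

Lemma ab_wordE (f : {additive {poly int} -> abelianization (fib_group r n s)}) :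
    (forall i : 'I_n, f 'X^i = ab_word [:: (i, true)]) ->
  forall w, f (exponents w) = ab_word w.
Proof.
move=> fX; elim=> [|[i b] w IHw].
  by rewrite /exponents big_nil raddf0.
rewrite /exponents big_cons raddfD -/(exponents w) IHw -(cat1s _ w) ab_word_cat.
by congr (_ + _); case: b; rewrite /= ?raddfN fX // ab_word_cancel.
Qed.

Lemma modXn1 i : I ('X^(i %% n)%N - 'X^i).
Proof.
rewrite {2}(divn_eq i n) exprD; move: (i %/ n)%N (i %% n)%N => q m.
rewrite mulnC exprM.
have -> : 'X^m - 'X^n ^+ q * 'X^m
    = (- 'X^m * (\sum_(k < q) 'X^n ^+ k)) * ('X^n - 1) :> {poly int}.
  by rewrite -mulrA [_ * ('X^n - 1)]mulrC -subrX1; ring.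
by apply: in_idealMl; exact: in_ideal_r.
Qed.

(** Before subscripts are reduced, the difference is exactly ['X^i * fib_poly r s]; their reduction
    modulo [n] is absorbed by [modXn1]. *)
Lemma exponents_rel (i : 'I_n) :
  I (exponents [seq (shift_idx i j, true) | j <- iota 0 r]
     - exponents [seq (shift_idx i (j + r), true) | j <- iota 0 s]).
Proof.
have IX (t : seq nat) (h : nat -> nat) :
    I (exponents [seq (shift_idx i (h j), true) | j <- t]
       - 'X^i * \sum_(j <- t) 'X^(h j)).
  rewrite /exponents big_map mulr_sumr -sumrB.
  by apply: in_ideal_sum => j /=; rewrite -exprD; exact: modXn1.
have := in_idealD (in_idealB (IX (iota 0 r) id) (IX (iota 0 s) (fun j => j + r)%N))
  (in_idealMl 'X^i (in_ideal_l (fib_poly r s) ('X^n - 1))).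
congr (in_ideal _ _ _) => //=.
by rewrite /fib_poly /index_iota !subn0; ring.
Qed.

Lemma exponents_cat u v : exponents (u ++ v) = exponents u + exponents v.
Proof. by rewrite /exponents big_cat. Qed.

Lemma exponents_inv u : exponents (inv_word u) = - exponents u.
Proof.
rewrite /exponents /inv_word (perm_big _ (permEl (perm_rev _))) big_map -sumrN.
by apply: eq_bigr => -[i []] _ //=; rewrite opprK.
Qed.

Lemma exponents_pres_eq u v : pres_eq rels u v -> I (exponents u - exponents v).
Proof.
elim=> {u v} [w|u v _ IH|v u w _ IHuv _ IHvw|u u' v v' _ IHu _ IHv|l
             |u v [i [-> ->]]].
- by rewrite subrr; exact: in_ideal0.
- by rewrite -opprB; exact: in_idealN.
- by rewrite -[_ - _](subrKA (exponents v)); exact: in_idealD.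
- by rewrite !exponents_cat opprD addrACA; exact: in_idealD.
- rewrite /exponents !big_cons !big_nil; case: l => i []/=.
    by rewrite addr0 subrr subr0; exact: in_ideal0.
  by rewrite addr0 addNr subr0; exact: in_ideal0.
- exact: exponents_rel.
Qed.

(** Commutators have zero exponent sums. The claim covers all words representing [x], because the
    induction builds words from those chosen for the factors; [red] passes from one representing
    word to another. *)
Lemma exponents_derived (x : fib_group r n s) :
  derived x -> forall w, x = word_class rels w -> I (exponents w).
Proof.
have cl (y : fib_group r n s) : exists v, y = word_class rels v.
  by exists (repr y); rewrite word_class_repr.
have red (u v : word 'I_n) : word_class rels u = word_class rels v ->
    I (exponents u) -> I (exponents v).
  move=> /word_classP/exponents_pres_eq Iuv Iu.
  by rewrite -[exponents v](subKr (exponents u)); exact: in_idealB.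
elim=> {x} [x y|w|x y _ IHx _ IHy w|x _ IHx w].
- move=> w; have [[u ->] [v ->]] := (cl x, cl y).
  have -> : [~ word_class rels u, word_class rels v]%g =
      word_class rels (inv_word u ++ (inv_word v ++ (u ++ v))).
    by rewrite -!presented_mulE -!presented_invE.
  move=> uvw; apply: red uvw _; rewrite !exponents_cat !exponents_inv.
  by rewrite [X in I X](_ : _ = 0); [exact: in_ideal0 | ring].
- move=> w1; apply: red w1 _.
  by rewrite /exponents big_nil; exact: in_ideal0.
- have [[u xu] [v yv]] := (cl x, cl y).
  move: (IHx u xu) (IHy v yv) => Iu Iv.
  rewrite xu yv [LHS]presented_mulE => uvw; apply: red uvw _.
  by rewrite exponents_cat; exact: in_idealD.
- have [u xu] := cl x; move: (IHx u xu) => Iu.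
  rewrite xu [LHS]presented_invE => uw; apply: red uw _.
  by rewrite exponents_inv; exact: in_idealN.
Qed.

Lemma exponents_onto p : exists w, I (p - exponents w).
Proof.
rewrite -[p]coefK poly_def.
apply: (@big_ind _ (fun q => exists w, I (q - exponents w))).
- by exists [::]; rewrite /exponents big_nil subrr; exact: in_ideal0.
- move=> q q' [w Iw] [w' Iw']; exists (w ++ w').
  by rewrite exponents_cat opprD addrACA; exact: in_idealD.
move=> i _; pose k : 'I_n := Ordinal (ltn_pmod i n_gt0); set c := p`_i.
(* The monomial c X^i is matched, modulo ['X^n - 1], by |c| copies of x_(i mod n) or of its inverse,
   according to the sign of c. *)
exists (nseq `|c|%N (k, (0 <= c)%R)).
have -> : exponents (nseq `|c|%N (k, (0 <= c)%R)) = c *: 'X^k.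
  rewrite /exponents big_nseq iter_addr_0 /=; case: (c) => m /=.
    by rewrite -scaler_nat natz.
  by rewrite NegzE scaleNr mulNrn -scaler_nat natz.
rewrite -scalerBr -mul_polyC -opprB mulrN -mulNr.
by apply: in_idealMl; exact: modXn1.
Qed.

(** [f] sends ['X^i] to the class of x_(i mod n) and kills both generators of the ideal. Conversely,
    [p] is congruent to some [exponents w]; if [f p = 0], then [w] represents an element of the
    derived subgroup and [exponents_derived] applies. *)
Theorem fib_abelianization :
  exists f : {additive {poly int} -> abelianization (fib_group r n s)},
    surjection_with_kernel I f.
Proof.
pose k i : 'I_n := Ordinal (ltn_pmod i n_gt0).
have [f fX] := poly_int_additive_exists (fun i => ab_word [:: (k i, true)]).
have fE w : f (exponents w) = ab_word w.
  apply: ab_wordE => i; rewrite fX; congr (ab_word [:: (_, _)]).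
  by apply: val_inj; rewrite /= modn_small.
have fI p : I p -> f p = 0.
  (* By additivity it suffices to test multipliers that are powers of ['X]. *)
  have f0 q : (forall j, f ('X^j * q) = 0) -> forall u, f (u * q) = 0.
    move=> fXq; have [|g gE] := @additive_exists _ _ (fun u => f (u * q)).
      by move=> u v; rewrite mulrBl raddfB.
    move=> u; rewrite -gE.
    by apply: (@eq_poly_int_additive _ g \0) => i; rewrite gE fXq.
  move=> [u [v ->]]; rewrite raddfD !f0 ?addr0// => j.
    rewrite mulrBr mulr1 -exprD raddfB !fX; apply/eqP; rewrite subr_eq0.
    by apply/eqP; congr (ab_word [:: (_, _)]); apply: val_inj; rewrite /= modnDr.
  have fsum (t : seq nat) h : f ('X^j * \sum_(i <- t) 'X^(h i))
      = ab_word [seq (shift_idx (k j) (h i), true) | i <- t].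
    rewrite -fE /exponents big_map mulr_sumr !raddf_sum; apply: eq_bigr => i _ /=.
    rewrite -exprD !fX; congr (ab_word [:: (_, _)]); apply: val_inj => /=.
    by rewrite modn_mod modnDml.
  rewrite /fib_poly mulrBr raddfB (fsum _ id) (fsum _ (fun i => i + r)%N).
  apply/eqP; rewrite subr_eq0 /index_iota !subn0; apply/eqP.
  congr (ab_class _); apply/word_classP/pres_eq_rel.
  by exists (k j).
exists f; split=> [a|p].
  exists (exponents (repr (repr a))); rewrite fE.
  by rewrite /ab_word word_class_repr ab_class_repr.
split; last exact: fI.
have [w pw] := exponents_onto p.
have /eqP := fI _ pw; rewrite raddfB subr_eq0 => /eqP-> fw.
have dw : derived (word_class rels w : fib_group r n s).
  have /ab_classP : ab_class 1%g = ab_word w by rewrite -fE.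
  by rewrite invg1 mul1g.
have Iw := exponents_derived dw erefl.
by rewrite -[p](subrK (exponents w)); exact: in_idealD.
Qed.

End FibAbelianization.

(** * Splitting a polynomial by exponents modulo d, and the ideal in these coordinates *)

Section PolySections.
Variable k : nat.
Let d := k.+1.
Implicit Types p q : {poly int}.

(* The p_i with p = \sum_(i < d) 'X^i * p_i('X^d). *)
Definition poly_section i p : {poly int} := \poly_(j < size p) p`_(i + d * j).

Lemma coef_poly_section i p j : (poly_section i p)`_j = p`_(i + d * j).
Proof.
rewrite coef_poly; case: ltnP => // sz_p; rewrite nth_default//.
by rewrite (leq_trans sz_p)// (leq_trans (leq_pmull j (ltn0Sn k)))// leq_addl.
Qed.

Fact poly_section_is_zmod_morphism i : zmod_morphism (poly_section i).
Proof. by move=> p q; apply/polyP => j; rewrite !(coefB, coef_poly_section). Qed.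

HB.instance Definition _ i := GRing.isZmodMorphism.Build {poly int} {poly int}
  (poly_section i) (poly_section_is_zmod_morphism i).

Lemma poly_sectionMXn i p :
  (i < d)%N -> poly_section i ('X^d * p) = 'X * poly_section i p.
Proof.
move=> lt_id; apply/polyP => j; rewrite coefXM !coef_poly_section coefXnM.
case: j => [|j]/=; first by rewrite muln0 addn0 lt_id.
by rewrite mulnS addnCA ltnNge leq_addr /= addKn.
Qed.

(** Sections are linear over Z[y], y acting as ['X^d]; induction on [q] reduces this to constants
    and to y. *)
Lemma poly_section_comp i q p :
  (i < d)%N -> poly_section i ((q \Po 'X^d) * p) = q * poly_section i p.
Proof.
move=> lt_id; elim/poly_ind: q p => [|q c IHq] p.
  by rewrite comp_poly0 !mul0r raddf0.
rewrite comp_polyD comp_polyM comp_polyX comp_polyC !mulrDl raddfD /= -!mulrA.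
congr (_ + _); last by apply/polyP => j; rewrite !(coefCM, coef_poly_section).
by rewrite IHq poly_sectionMXn.
Qed.

Lemma poly_sectionXM i p : poly_section i.+1 ('X * p) = poly_section i p.
Proof. by apply/polyP => j; rewrite !coef_poly_section coefXM. Qed.

Lemma poly_sectionXn i j :
  (i < d)%N -> (j < d)%N -> poly_section i 'X^j = (i == j)%:R.
Proof.
move=> lt_id lt_jd; apply/polyP => m.
rewrite coef_poly_section coefXn -polyC_natr coefC.
case: m => [|m] /=; first by rewrite muln0 addn0.
by rewrite mulnS gtn_eqF// addnCA ltn_addr.
Qed.

Lemma poly_section_sum i (c : nat -> {poly int}) : (i < d)%N ->
  poly_section i (\sum_(j < d) (c j \Po 'X^d) * 'X^j) = c i.
Proof.
move=> lt_id; rewrite raddf_sum (bigD1 (Ordinal lt_id))//= big1 => [|j].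
  by rewrite poly_section_comp// poly_sectionXn// eqxx mulr1 addr0.
rewrite -val_eqE/= => ji.
by rewrite poly_section_comp// poly_sectionXn// eq_sym (negPf ji) mulr0.
Qed.

Lemma poly_sectionE p : p = \sum_(j < d) (poly_section j p \Po 'X^d) * 'X^j.
Proof.
(* Every exponent [m] is i + d j with i < d, so the sections see all coefficients. *)
have secE q : (forall i, (i < d)%N -> poly_section i q = 0) -> q = 0.
  move=> q0; apply/polyP => m; rewrite coef0 (divn_eq m d) addnC mulnC.
  by rewrite -coef_poly_section q0 ?coef0// ltn_pmod.
apply/eqP; rewrite -subr_eq0; apply/eqP/secE => i lt_id.
by rewrite raddfB/= (poly_section_sum (fun j => poly_section j p))// subrr.
Qed.

End PolySections.

Section SectionIdeal.
Variables (k : nat) (a b : {poly int}).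

Let d := k.+1.
Let Phi : {poly int} := \sum_(i < d) 'X^i.
Let sec := poly_section k.

(** The difference of sections m and m + 1 of [u * Phi] is section m + 1 of [u * Phi * ('X - 1)].
    That product is [u * ('X^d - 1)], so the difference is a multiple of y - 1. Such differences
    telescope from [k] down to [i]. *)
Lemma poly_section_geometric u i : (i <= k)%N ->
  exists w, sec i (u * Phi) - sec k (u * Phi) = w * ('X - 1).
Proof.
move=> /subKn <-; elim: (k - i)%N => [|j [w wE]].
  by exists 0; rewrite subn0 subrr mul0r.
(* For [j] at least [k], truncated subtraction makes both indices 0. *)
have [le_kj|lt_jk] := leqP k j.
  by exists w; rewrite -wE (_ : k - j.+1 = k - j)%N; last lia.
pose m := (k - j.+1)%N; have mE : (k - j)%N = m.+1 by rewrite /m; lia.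
exists (w + sec m.+1 u); rewrite mulrDl -wE mE -/m.
have -> : sec m.+1 u * ('X - 1) = sec m.+1 (u * Phi * ('X - 1)).
  rewrite -mulrA [Phi * _]mulrC -subrX1.
  have -> : u * ('X^d - 1) = (('X - 1) \Po 'X^d) * u :> {poly int}.
    by rewrite comp_polyB comp_polyX comp_polyC mulrC.
  by rewrite /sec poly_section_comp 1?mulrC// /d /m; lia.
rewrite /sec mulrBr mulr1 raddfB /= [u * Phi * _]mulrC poly_sectionXM//.
by ring.
Qed.

(** Forward, this is Z[y]-linearity with [poly_section_geometric]. Backward, [p] is p_k(X^d) Phi
    plus the sum of the (p_j - p_k)(X^d) X^j; there y - 1 becomes X^d - 1 = (X - 1) Phi, which
    supplies the factor Phi of the first generator. *)
Lemma in_ideal_sections p :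
  in_ideal ((a \Po 'X^d) * Phi) (b \Po 'X^d) p <->
  in_ideal a b (sec k p) /\
  forall i, (i < k)%N -> in_ideal (('X - 1) * a) b (sec i p - sec k p).
Proof.
have secM i q v : (i <= k)%N -> sec i (v * (q \Po 'X^d)) = q * sec i v.
  by move=> le_ik; rewrite mulrC /sec poly_section_comp.
split=> [[u [v ->]]|[[u [v secp]] secB]].
  have secE i : (i <= k)%N -> sec i (u * ((a \Po 'X^d) * Phi) + v * (b \Po 'X^d))
      = a * sec i (u * Phi) + b * sec i v.
    move=> le_ik; rewrite /sec raddfD /= -/sec.
    by rewrite [(a \Po _) * _]mulrC mulrA !secM.
  split=> [|i /ltnW lt_ik].
    by rewrite secE//; exists (sec k (u * Phi)), (sec k v); ring.
  rewrite !secE//; have [w wE] := poly_section_geometric u lt_ik.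
  by exists w, (sec i v - sec k v); rewrite mulrA -wE; ring.
have IPhi i : (i < k)%N -> exists uv : {poly int} * {poly int},
    sec i p - sec k p = uv.1 * (('X - 1) * a) + uv.2 * b.
  by move=> /secB [u' [v' E]]; exists (u', v').
rewrite [p](@poly_sectionE k)//.
have -> : \sum_(j < d) (poly_section k j p \Po 'X^d) * 'X^j =
    (sec k p \Po 'X^d) * Phi + \sum_(j < d) ((sec j p - sec k p) \Po 'X^d) * 'X^j.
  rewrite mulr_sumr -big_split; apply: eq_bigr => j _ /=.
  by rewrite -mulrDl -comp_polyD addrC subrK.
apply: in_idealD.
  exists (u \Po 'X^d), ((v \Po 'X^d) * Phi).
  by rewrite secp comp_polyD !comp_polyM; ring.
apply: in_ideal_sum => -[j /=]; rewrite ltnS leq_eqVlt => /orP[/eqP->|lt_jk].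
  by rewrite subrr comp_poly0 mul0r; exact: in_ideal0.
have [[u' v'] /= ->] := IPhi j lt_jk.
exists ((u' \Po 'X^d) * ('X - 1) * 'X^j), ((v' \Po 'X^d) * 'X^j).
rewrite comp_polyD !comp_polyM comp_polyB comp_polyX comp_polyC subrX1 -/Phi.
by ring.
Qed.

End SectionIdeal.

(** * Splitting off the value at 1 *)

Lemma Xsub1_neq0 : 'X - 1 != 0 :> {poly int}.
Proof. by rewrite -polyC1 polyXsubC_eq0. Qed.

(** Quotients by the regular element ['X - 1] are unique, so the chosen ones depend additively on
    [p]. *)
Lemma quotient_XsubC1 : exists h : {additive {poly int} -> {poly int}},
  forall p, p = h p * ('X - 1) + p.[1]%:P.
Proof.
have ex (p : {poly int}) : exists q, p = q * ('X - 1) + p.[1]%:P.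
  have /factor_theorem[q qE] : root (p - p.[1]%:P) 1.
    by rewrite /root !hornerE subrr.
  by exists q; rewrite -polyC1 -qE subrK.
have [h hE] := choice ex.
have [p q|g gE] := @additive_exists _ _ h; last by exists g => p; rewrite gE.
apply: (mulIf Xsub1_neq0); rewrite mulrBl.
have E t : h t * ('X - 1) = t - t.[1]%:P by apply/eqP; rewrite eq_sym subr_eq -hE.
by rewrite !E hornerD hornerN polyCB; ring.
Qed.

Lemma horner_Xsub1 : ('X - 1).[1] = 0 :> int.
Proof. by rewrite !hornerE subrr. Qed.

(** Both generators vanish at 1, and ['X - 1] cancels. So [h] and the value at 1 split the quotient
    as Z[y]/(a, c) (+) Z. *)
Lemma in_ideal_XsubC1 (h : {additive {poly int} -> {poly int}}) a c p :
    (forall p, p = h p * ('X - 1) + p.[1]%:P) ->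
  in_ideal (('X - 1) * a) (('X - 1) * c) p <-> in_ideal a c (h p) /\ p.[1] = 0.
Proof.
move=> hE; split=> [[u [v pE]]|[[u [v huv]] p1]]; last first.
  by exists u, v; rewrite (hE p) p1 huv addr0; ring.
have p1 : p.[1] = 0.
  by rewrite pE hornerD !hornerM horner_Xsub1 !(mulr0, mul0r) addr0.
split=> //; exists u, v.
apply: (mulIf Xsub1_neq0); have := hE p; rewrite p1 addr0 => <-; rewrite pE; ring.
Qed.

(** The coordinates of [f] are the class of p_k in [B] and, for i < k, the class in [T] of [h] of
    p_i - p_k together with its value at 1. *)
Theorem section_decomposition (k : nat) (a c : {poly int}) (B T : zmodType)
    (pB : {additive {poly int} -> B}) (pT : {additive {poly int} -> T}) :
    surjection_with_kernel (in_ideal a (('X - 1) * c)) pB ->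
    surjection_with_kernel (in_ideal a c) pT ->
  exists f : {additive {poly int} -> ((B * 'rV[T]_k) * 'rV[int]_k)%type},
    surjection_with_kernel
      (in_ideal ((a \Po 'X^(k.+1)) * \sum_(i < k.+1) 'X^i)
                ((('X - 1) * c) \Po 'X^(k.+1))) f.
Proof.
move=> [pBS pBK] [pTS pTK]; have [h hE] := quotient_XsubC1.
pose q i p := poly_section k i p - poly_section k k p.
have qB i p p' : q i (p - p') = q i p - q i p' by rewrite /q !raddfB /=; ring.
have [|f fE] := @additive_exists {poly int} ((B * 'rV[T]_k) * 'rV[int]_k)%type
  (fun p => (pB (poly_section k k p), \row_(i < k) pT (h (q i p)),
             \row_(i < k) (q i p).[1])).
  move=> p p'; rewrite !raddfB /=; congr (_, _, _).
    by apply/rowP => i; rewrite !mxE qB !raddfB.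
  by apply/rowP => i; rewrite !mxE qB hornerD hornerN.
exists f; split=> [[[y t] z]|p].
  have [u uE] := pBS y.
  have [v vE] := choice (fun i => pTS (t 0 i)).
  (* Sections of the preimage: u at index [k], where [insub] fails, and u + v_i (y - 1) + z_i below
     it, so that subtracting u leaves quotient v_i and value z_i. *)
  pose c' i : {poly int} :=
    if insub i is Some j then u + v j * ('X - 1) + (z 0 j)%:P else u.
  exists (\sum_(j < k.+1) (c' j \Po 'X^(k.+1)) * 'X^j).
  rewrite fE poly_section_sum//.
  have qE (i : 'I_k) : q i (\sum_(j < k.+1) (c' j \Po 'X^(k.+1)) * 'X^j)
      = v i * ('X - 1) + (z 0 i)%:P.
    rewrite /q !poly_section_sum ?ltnS ?(ltnW (ltn_ord i))// /c' valK.
    rewrite insubF ?ltnn//.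
    by ring.
  have hqE (i : 'I_k) : h (v i * ('X - 1) + (z 0 i)%:P) = v i.
    apply: (mulIf Xsub1_neq0); set w := v i * ('X - 1) + (z 0 i)%:P.
    have w1 : w.[1] = z 0 i.
      by rewrite /w hornerD hornerM horner_Xsub1 hornerC mulr0 add0r.
    by apply: (addIr (z 0 i)%:P); rewrite -{1}w1 -hE.
  congr (_, _, _); first by rewrite /c' insubF ?ltnn.
    by apply/rowP => i; rewrite mxE qE hqE vE.
  apply/rowP => i; rewrite mxE qE.
  by rewrite hornerD hornerM horner_Xsub1 hornerC mulr0 add0r.
rewrite in_ideal_sections fE; split=> [[/pBK ? /rowP tE /rowP zE]|[/pBK-> qI]].
  split=> // i lt_ik; rewrite (@in_ideal_XsubC1 h)//; split.
    by apply/pTK; have := tE (Ordinal lt_ik); rewrite !mxE.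
  by have := zE (Ordinal lt_ik); rewrite !mxE.
congr (_, _, _); apply/rowP => i; rewrite !mxE.
  by apply/pTK; have /(in_ideal_XsubC1 _ _ _ hE)[] := qI i (ltn_ord i).
by have /(in_ideal_XsubC1 _ _ _ hE)[] := qI i (ltn_ord i).
Qed.

(** * Identities for the relator polynomial *)

Lemma fib_polyM r s :
  fib_poly r s * ('X - 1) = ('X^r - 1) - 'X^r * ('X^s - 1).
Proof.
rewrite /fib_poly !subrX1 !big_mkord.
have -> : \sum_(i < s) 'X^(i + r) = 'X^r * \sum_(i < s) 'X^i :> {poly int}.
  by rewrite mulr_sumr; apply: eq_bigr => i _; rewrite addnC exprD.
by ring.
Qed.

Lemma fib_poly1 r s : (fib_poly r s).[1] = r%:Z - s%:Z.
Proof.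
rewrite /fib_poly hornerD hornerN !horner_sum; congr (_ - _).
  rewrite (eq_bigr (fun=> 1)) ?big_const_nat ?subn0 ?iter_addr_0 ?natz//.
  by move=> i _; rewrite hornerXn expr1n.
rewrite (eq_bigr (fun=> 1)) ?big_const_nat ?subn0 ?iter_addr_0 ?natz//.
by move=> i _; rewrite hornerXn expr1n.
Qed.

(** Multiplying by ['X - 1] turns the geometric sum into X^d - 1, that is ['X - 1] composed with
    ['X^d]; then [fib_polyM] computes both sides. *)
Lemma fib_poly_comp d r s : (0 < d)%N ->
  fib_poly (d * r) (d * s) = (fib_poly r s \Po 'X^d) * \sum_(i < d) 'X^i.
Proof.
move=> d_gt0; apply: (mulIf Xsub1_neq0).
rewrite fib_polyM -mulrA [_ * ('X - 1)]mulrC -subrX1.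
have -> : 'X^d - 1 = ('X - 1) \Po 'X^d :> {poly int}.
  by rewrite comp_polyB comp_polyX -polyC1 comp_polyC.
rewrite -comp_polyM fib_polyM !(comp_polyB, comp_polyM) !comp_Xn_poly -!exprM.
by rewrite -polyC1 comp_polyC.
Qed.

(** * The quotients for coprime parameters *)

Section UnityRoots.
Variables (N R S : nat).
Hypotheses (N_gt0 : (0 < N)%N) (coRNS : gcdn (gcdn R N) S = 1%N).

Let m : {poly int} := 'X^N - 1.

Let m_monic : m \is monic. Proof. exact: monic_Xn_sub_1. Qed.

Let mE : m = ('X - 1) * \sum_(i < N) 'X^i. Proof. exact: subrX1. Qed.

(* The triangle inequality is strict unless both terms of z^-R + z^S = 2 are 1. *)
Lemma fib_unity_root (z : algC) :
  z ^+ N = 1 -> 1 + z ^+ (R + S) = 2 * z ^+ R -> z = 1.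
Proof.
move=> zN zRS.
have z_norm : `|z| = 1.
  by apply/eqP; rewrite -(pexpr_eq1 N_gt0)// -normrX zN normr1.
have z_neq0 : z != 0 by rewrite -normr_eq0 z_norm oner_eq0.
pose F (b : bool) := if b then z ^- R else z ^+ S.
have F1 b : F b = 1.
  apply: (@normC_sum_upper _ _ predT F (fun=> 1)) => //.
    by move=> [] _; rewrite /F ?normfV normrX z_norm expr1n ?invr1.
  rewrite !big_bool /F /=; apply: (mulfI (expf_neq0 R z_neq0)).
  by rewrite mulrDr mulfV ?expf_neq0// -exprD zRS mulrC.
have zR : z ^+ R = 1.
  by have := F1 true; rewrite /F => /(congr1 GRing.inv); rewrite invrK invr1.
have zS : z ^+ S = 1 := F1 false.
have [k k_prim _] := prim_order_exists N_gt0 zN.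
have : (k %| gcdn (gcdn R N) S)%N.
  by rewrite !dvdn_gcd !(prim_order_dvd k_prim) zR zN zS eqxx.
rewrite coRNS dvdn1 => /eqP k1; have := prim_expr_order k_prim.
by rewrite k1 expr1.
Qed.

Section Finite.
Hypothesis neqRS : R <> S.

Let F := fib_poly R S.

(** If F is not constant, [c] is the resultant of F and X^N - 1. Were it zero, they would share a
    complex root, which is 1 by [fib_unity_root]; but F(1) = R - S is nonzero. *)
Lemma fib_poly_bezout : exists2 c : int, c != 0 & in_ideal F m c%:P.
Proof.
have F1 : F.[1] != 0 by rewrite fib_poly1; apply/eqP; lia.
(* [resultant_in_ideal] asks for nonconstant polynomials; a constant [F] is itself the required
   integer. *)
have [/size1_polyC FC|sz_F] := leqP (size F) 1.
  exists F`_0; last by rewrite -FC; exact: in_ideal_l.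
  by move: F1; rewrite FC hornerC coefC eqxx.
have sz_m : (1 < size m)%N by rewrite size_Xn_sub_1.
have [[u v] /= _ res] := resultant_in_ideal sz_F sz_m.
exists (resultant F m); last by exists u, v.
rewrite resultant_eq0 -leqNgt leqNgt; apply/negP => sz_gcd.
pose toC := map_poly (intr : int -> algC).
have /closed_rootP[z z_root] : size (toC (gcdp F m)) != 1%N.
  rewrite size_map_inj_poly ?rmorph0//; last exact: intr_inj.
  by case: (size _) sz_gcd => [|[]].
(* Over Z, [gcdp] divides only up to a nonzero scalar, which cancels after evaluation in [algC]. *)
have root_dvd p : gcdp F m %| p -> (toC p).[z] = 0.
  move=> /Pdiv.Idomain.dvdpP[[c q] /= c_neq0 pE].
  have /eqP := congr1 (fun p => (toC p).[z]) pE.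
  rewrite /toC -mul_polyC !rmorphM /= !hornerM (rootP z_root) mulr0.
  rewrite map_polyC hornerC.
  by rewrite mulf_eq0 intr_eq0 (negPf c_neq0) => /eqP.
have zF := root_dvd _ (dvdp_gcdl F m).
have z1 : z = 1.
  apply: fib_unity_root.
    have := root_dvd _ (dvdp_gcdr F m).
    rewrite /toC rmorphB /= map_polyXn rmorph1 !hornerE => /eqP.
    by rewrite subr_eq0 => /eqP.
  (* With F(z) = 0, [fib_polyM] at z reads 1 + z^(R + S) = 2 z^R. *)
  have := congr1 (fun p => (toC p).[z]) (fib_polyM R S).
  rewrite [toC (_ * _)]rmorphM /= -/F hornerM zF mul0r /toC !(rmorphB, rmorphM) /=.
  rewrite !map_polyXn rmorph1 !hornerE mulrBr mulr1 => /esym/eqP.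
  rewrite subr_eq0 exprD => /eqP E; rewrite -[X in _ + X](subrK (z ^+ R)) -E; ring.
move: zF; rewrite z1 -[1]/(1%:~R) horner_map => /eqP.
by rewrite intr_eq0 (negPf F1).
Qed.

(** Z[x]/(m) is torsion-free as m is monic: the remainder [t] of [g] has degree below that of m, yet
    c t is a multiple of m. *)
Lemma monic_dvd_torsion (c : int) g w :
  c != 0 -> c *: g = w * m -> exists v, g = v * m.
Proof.
move=> c_neq0 cg; pose q := Pdiv.Ring.rdivp g m; pose t := Pdiv.Ring.rmodp g m.
have gE : g = q * m + t by exact: Pdiv.RingMonic.rdivp_eq.
have sz_t : (size t < size m)%N by apply: Pdiv.Ring.ltn_rmodpN0; exact: monic_neq0.
have ct : c *: t = (w - c *: q) * m.
  by rewrite mulrBl -cg gE -scalerAl; rewrite scalerDr; ring.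
exists q; rewrite gE; suff -> : t = 0 by rewrite addr0.
apply/eqP; have [//|t_neq0] := eqVneq t 0; exfalso.
have w_neq0 : w - c *: q != 0.
  apply: contra_neq t_neq0 => w0; move: ct; rewrite w0 mul0r => /eqP.
  by rewrite scale_poly_eq0 (negPf c_neq0) => /eqP.
have := congr1 (size \o polyseq) ct; rewrite /= size_scale// size_Mmonic// => szE.
move: sz_t w_neq0; rewrite szE -size_poly_gt0; case: (size (w - _)) => // k.
by rewrite ltnNge leq_addl.
Qed.

(** Bounds the order of [Nm] in B from below. If i Nm = u F + v m, then c u (X - 1) is a multiple of
    m, hence so is u (X - 1), and Nm divides u. Cancelling Nm leaves i = w F + v (X - 1), evaluated
    at 1. *)
Lemma in_ideal_norm (i : int) :
  in_ideal F m (i%:P * \sum_(j < N) 'X^j) -> exists q, i = q * (R%:Z - S%:Z).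
Proof.
set Nm := \sum_(j < N) _ => -[u [v iNm]].
have [c c_neq0 [al [be cE]]] := fib_poly_bezout.
have Nm_neq0 : Nm != 0.
  by apply: contra_neq (monic_neq0 m_monic); rewrite mE -/Nm => ->; rewrite mulr0.
have [w uE] : exists w, u = w * Nm.
  have [|w wE] := @monic_dvd_torsion c (u * ('X - 1))
    (al * i%:P - al * v * ('X - 1) + be * u * ('X - 1)) c_neq0.
    rewrite -mul_polyC cE.
    have uF : u * F = i%:P * Nm - v * m by rewrite iNm addrK.
    transitivity (al * ('X - 1) * (u * F) + be * m * u * ('X - 1)).
      by ring.
    by rewrite uF mE -/Nm; ring.
  exists w; apply: (mulIf Xsub1_neq0); rewrite wE mE -/Nm; ring.
have iE : i%:P = w * F + v * ('X - 1).
  apply: (mulIf Nm_neq0); rewrite iNm uE mE -/Nm; ring.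
exists w.[1]; have := congr1 (horner^~ 1) iE.
by rewrite hornerD !hornerM horner_Xsub1 mulr0 addr0 hornerC fib_poly1.
Qed.

(** Reduce modulo the monic m, then reduce the N coefficients modulo the integer [c] of the
    ideal. *)
Lemma finite_representatives :
  exists s : seq {poly int}, forall p, exists2 q, q \in s & in_ideal F m (p - q).
Proof.
have [c c_neq0 Ic] := fib_poly_bezout.
pose rep (t : {ffun 'I_N -> 'I_`|c|}) : {poly int} :=
  \poly_(i < N) (if insub i is Some j then (t j : nat)%:Z else 0).
exists (map rep (enum {: {ffun 'I_N -> 'I_`|c|}})) => p.
have p_mod i : (`|((Pdiv.Ring.rmodp p m)`_i %% c)%Z|%N < `|c|%N)%N.
  by rewrite -ltz_nat gez0_abs ?modz_ge0// ltz_mod.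
pose t := [ffun j : 'I_N => Ordinal (p_mod j)].
pose q : {poly int} := \poly_(i < N) ((Pdiv.Ring.rmodp p m)`_i %/ c)%Z.
exists (rep t); first by rewrite map_f ?mem_enum.
have sz_r : (size (Pdiv.Ring.rmodp p m) <= N)%N.
  rewrite -ltnS -(size_Xn_sub_1 int N_gt0).
  by apply: Pdiv.Ring.ltn_rmodpN0; exact: monic_neq0.
have rE : Pdiv.Ring.rmodp p m - rep t = q * c%:P.
  apply/polyP => i; rewrite coefB coefMC !coef_poly.
  case: ltnP => iN; last by rewrite nth_default ?(leq_trans sz_r)// mul0r subr0.
  rewrite insubT/= ffunE/= gez0_abs ?modz_ge0//.
  by rewrite [X in X - _](divz_eq _ c) addrK.
rewrite [p in p - _](Pdiv.RingMonic.rdivp_eq m_monic) -addrA rE.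
by apply: in_idealD; apply: in_idealMl => //; exact: in_ideal_r.
Qed.
Let Nm : {poly int} := \sum_(j < N) 'X^j.

Lemma in_ideal_norm_factor p : in_ideal F m p -> in_ideal F Nm p.
Proof. by move=> [u [v ->]]; exists u, (v * ('X - 1)); rewrite mE -/Nm; ring. Qed.

(** Multiply F = h(F) (X - 1) + (R - S) by [Nm]. *)
Lemma in_ideal_norm_multiple : in_ideal F m ((R%:Z - S%:Z)%:P * Nm).
Proof.
have [h hE] := quotient_XsubC1; exists Nm, (- h F).
have := hE F; rewrite fib_poly1 => {1}->; rewrite mE -/Nm; ring.
Qed.

(** Each element of [B] is uniquely the class of tau(t) + i Nm with t in [T] and 0 <= i < |R - S|.
    Uniqueness of i is [in_ideal_norm]; the bound on i comes from [in_ideal_norm_multiple]. *)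
Theorem finite_quotients :
  exists (B T : finZmodType) (pB : {additive {poly int} -> B})
         (pT : {additive {poly int} -> T}),
    [/\ surjection_with_kernel (in_ideal F m) pB,
        surjection_with_kernel (in_ideal F Nm) pT
      & #|B| = (#|T| * `|R%:Z - S%:Z|)%N].
Proof.
have [s s_rep] := finite_representatives.
have [B [pB pBP]] := finite_quotient (in_ideal0 F m) (@in_idealB F m) s_rep.
have s_rep' p : exists2 q, q \in s & in_ideal F Nm (p - q).
  by have [q qs /in_ideal_norm_factor] := s_rep p; exists q.
have [T [pT pTP]] := finite_quotient (in_ideal0 F Nm) (@in_idealB F Nm) s_rep'.
exists B, T, pB, pT; split=> //; case: pBP pTP => [pBS pBK] [pTS pTK].
set e := `|_|%N; have [tau tauK] := choice pTS.
have e_gt0 : (0 < e)%N by rewrite /e; lia.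
pose g (x : T * 'I_e) := pB (tau x.1 + (x.2 : nat)%:Z%:P * Nm).
have g_inj : injective g.
  move=> [t i] [t' i'] /= /eqP; rewrite /g /= -subr_eq0 -raddfB => /eqP/pBK I_tt'.
  have tt' : t = t'.
    apply/eqP; rewrite -subr_eq0 -(tauK t) -(tauK t') -raddfB; apply/eqP/pTK.
    have := in_idealB (in_ideal_norm_factor I_tt')
      (in_idealMl (i%:Z%:P - i'%:Z%:P) (in_ideal_r F Nm)).
    by congr (in_ideal _ _ _); ring.
  move: I_tt'; rewrite tt' opprD addrACA subrr add0r -mulrBl -polyCB.
  move=> /in_ideal_norm[q qE]; congr (_, _); apply: val_inj => /=.
  have := congr1 absz qE; rewrite abszM -/e.
  (* Both indices are below [e], so |i - i'| = |q| e forces q = 0. *)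
  case: `|q|%N => [|a]; first by lia.
  rewrite mulSn; move: (ltn_ord i) (ltn_ord i'); lia.
have g_surj b : exists x, g x = b.
  have [p <-] := pBS b; pose t := pT p.
  have [u [v uv]] : in_ideal F Nm (p - tau t).
    by apply/pTK; rewrite raddfB tauK subrr.
  have [h hE] := quotient_XsubC1.
  have lt_e : (`|(v.[1] %% e)%Z| < e)%N.
    by rewrite -ltz_nat gez0_abs ?modz_ge0 ?ltz_pmod//; lia.
  exists (t, Ordinal lt_e); rewrite /g /= gez0_abs; last by rewrite modz_ge0//; lia.
  apply/eqP; rewrite eq_sym -subr_eq0 -raddfB; apply/eqP/pBK.
  have I_e : in_ideal F m (e%:Z%:P * Nm).
    have [->|->] : e%:Z = R%:Z - S%:Z \/ e%:Z = - (R%:Z - S%:Z) by lia.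
      exact: in_ideal_norm_multiple.
    by rewrite polyCN mulNr; apply: in_idealN; exact: in_ideal_norm_multiple.
  have := in_idealD (in_idealMl u (in_ideal_l F m)) (in_idealD
    (in_idealMl (h v) (in_ideal_r F m)) (in_idealMl (v.[1] %/ e)%Z%:P I_e)).
  congr (in_ideal _ _ _).
  (* Since (X - 1) Nm = m and e Nm lies in the ideal, only v(1) modulo [e] matters. *)
  have vE : v * Nm = (h v * ('X - 1)
      + ((v.[1] %/ e)%Z * e%:Z + (v.[1] %% e)%Z)%:P) * Nm.
    by rewrite -divz_eq -hE.
  rewrite opprD [in RHS]addrA uv vE.
  by rewrite polyCD polyCM mE -/Nm; ring.
have [g' g'K] := choice g_surj.
rewrite -[e in RHS]card_ord -card_prod; symmetry; apply: (@bij_eq_card _ _ g).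
by exists g' => // x; apply: g_inj.
Qed.

End Finite.

Section Equal.
Hypothesis eqRS : R = S.

Let F := fib_poly R S.

(** Here R and N are coprime; from u R = v N + 1, ['X - 1] is a combination of X^R - 1 and m. As F =
    -(X^R - 1) [sR], it remains to put X^R - 1 itself in the ideal. *)
Lemma in_ideal_Xsub1 : in_ideal F m ('X - 1).
Proof.
have Fsum : F = - ('X^R - 1) * \sum_(j < R) 'X^j.
  apply: (mulIf Xsub1_neq0).
  by rewrite fib_polyM -eqRS -mulrA [_ * ('X - 1)]mulrC -subrX1; ring.
(* The Bezout relation is taken for R > 0; if R = S = 0, coprimality gives N = 1 and m is
   ['X - 1]. *)
have [R0|R_gt0] := posnP R.
  have N1 : N = 1%N by move: coRNS; rewrite -eqRS R0 gcd0n gcdn0.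
  by rewrite /m N1 -[X in X - 1]expr1; exact: in_ideal_r.
have [u v uv _] := egcdnP N R_gt0.
have g1 : gcdn R N = 1%N.
  by apply/eqP; rewrite -dvdn1 -coRNS -eqRS dvdn_gcd dvdnn dvdn_gcdl.
rewrite g1 in uv.
have vE : 'X^(v * N) - 1 = (\sum_(i < v) ('X^N) ^+ i) * m :> {poly int}.
  by rewrite mulnC exprM subrX1 mulrC.
have uE : 'X^(u * R) - 1 = ('X^R - 1) * (\sum_(i < u) ('X^R) ^+ i) :> {poly int}.
  by rewrite mulnC exprM subrX1.
set sv := \sum_(i < v) _ in vE; set su := \sum_(i < u) _ in uE.
set sR := \sum_(j < R) _ in Fsum.
have RE : 'X^R - 1 = ('X - 1) * sR :> {poly int} by rewrite subrX1.
have XE : 'X - 1 = ('X^R - 1) * su - 'X * sv * m :> {poly int}.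
  by rewrite -uE uv -mulrA -vE addn1 exprS; ring.
(* Multiplying [XE] by [sR] yields X^R - 1 on the left and - [su] F modulo m on the right. *)
have IR : in_ideal F m ('X^R - 1).
  exists (- su), (- 'X * sv * sR).
  by rewrite Fsum {1}RE {1}XE; ring.
rewrite XE; apply: in_idealB; last by apply: in_idealMl; exact: in_ideal_r.
by rewrite mulrC; exact: in_idealMl.
Qed.

Let Nm : {poly int} := \sum_(j < N) 'X^j.

Lemma in_ideal_fib_eq p : in_ideal F m p <-> p.[1] = 0.
Proof.
split=> [[u [v ->]]|p1].
  rewrite hornerD !hornerM fib_poly1 mE hornerM horner_Xsub1 eqRS subrr.
  by rewrite mul0r !mulr0.
have [h hE] := quotient_XsubC1; rewrite (hE p) p1 addr0.
by apply: in_idealMl; exact: in_ideal_Xsub1.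
Qed.

Lemma horner_norm : Nm.[1] = N%:Z.
Proof.
rewrite /Nm horner_sum (eq_bigr (fun=> 1)) ?sumr_const ?card_ord ?natz// => i _.
by rewrite hornerXn expr1n.
Qed.

(** The ideal contains (F, m) = (X - 1), so only values at 1 count; those of the generators are 0
    and N. *)
Lemma in_ideal_fib_norm_eq p : in_ideal F Nm p <-> exists q, p.[1] = q * N%:Z.
Proof.
split=> [[u [v ->]]|[q p1]].
  exists v.[1]; rewrite hornerD !hornerM fib_poly1 horner_norm eqRS subrr.
  by rewrite mulr0 add0r.
rewrite -[p](subrK (q%:P * Nm)); apply: in_idealD; last first.
  by apply: in_idealMl; exact: in_ideal_r.
have /in_ideal_fib_eq[u [v ->]] : (p - q%:P * Nm).[1] = 0.
  by rewrite hornerD hornerN hornerM hornerC horner_norm p1 subrr.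
by exists u, (v * ('X - 1)); rewrite mE -/Nm; ring.
Qed.

Theorem equal_quotients :
  (exists pB : {additive {poly int} -> int},
     surjection_with_kernel (in_ideal F m) pB) /\
  exists (T : finZmodType) (pT : {additive {poly int} -> T}),
    surjection_with_kernel (in_ideal F Nm) pT /\ #|T| = N.
Proof.
split.
  have [|pB pBE] := @additive_exists {poly int} int (fun p => p.[1]).
    by move=> p q; rewrite hornerD hornerN.
  exists pB; split=> [i|p]; first by exists i%:P; rewrite pBE hornerC.
  by rewrite pBE in_ideal_fib_eq.
have N_neq0 : N%:Z != 0 by lia.
pose rem (p : {poly int}) := `|(p.[1] %% N)%Z|%N.
have remE p : (rem p)%:Z = (p.[1] %% N)%Z by rewrite gez0_abs// modz_ge0.
have rem_lt p : (rem p < N)%N by rewrite -ltz_nat remE ltz_pmod.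
have rem_mod p : in_ideal F Nm (p - (rem p)%:Z%:P).
  apply/in_ideal_fib_norm_eq; exists (p.[1] %/ N)%Z.
  by rewrite hornerD hornerN hornerC remE [X in X - _](divz_eq _ N) addrK.
(* The constants 0, ..., N - 1 represent all classes. *)
have [|T [pT pTP]] := finite_quotient (in_ideal0 F Nm) (@in_idealB F Nm)
  (s := [seq (i : nat)%:Z%:P | i <- iota 0 N]).
  move=> p; exists (rem p)%:Z%:P => //.
  by apply/mapP; exists (rem p); rewrite // mem_iota add0n rem_lt.
exists T, pT; split=> //; case: pTP => pTS pTK.
pose g (i : 'I_N) := pT (i : nat)%:Z%:P.
have g_inj : injective g.
  move=> i j /eqP; rewrite -subr_eq0 -raddfB => /eqP/pTK/in_ideal_fib_norm_eq[q].
  rewrite hornerD hornerN !hornerC => /(congr1 absz); rewrite abszM => ijE.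
  apply: val_inj => /=; move: ijE (ltn_ord i) (ltn_ord j).
  by case: `|q|%N => [|a]; rewrite ?mulSn; lia.
have g_surj t : exists i, g i = t.
  have [p <-] := pTS t; exists (Ordinal (rem_lt p)); rewrite /g /=.
  by apply/eqP; rewrite eq_sym -subr_eq0 -raddfB; apply/eqP/pTK.
have [g' g'K] := choice g_surj.
rewrite -[RHS]card_ord; symmetry; apply: (@bij_eq_card _ _ g).
by exists g' => // x; apply: g_inj.
Qed.

End Equal.

End UnityRoots.

(** * Assembling the two cases *)

Lemma surjection_with_kernel_bij (V G H : zmodType) (K : V -> Prop)
    (f : {additive V -> G}) (g : {additive G -> H}) :
    surjection_with_kernel K f -> bijective g ->
  exists h : {additive V -> H}, surjection_with_kernel K h.
Proof.
move=> [fS fK] [g' gK g'K]; have [|h hE] := @additive_exists _ _ (g \o f).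
  by move=> x y; rewrite /= !raddfB.
exists h; split=> [y|x].
  by have [x fx] := fS (g' y); exists x; rewrite hE /= fx g'K.
rewrite hE -fK /=; split=> [gfx|->]; last exact: raddf0.
by apply: (can_inj gK); rewrite gfx raddf0.
Qed.

(** For R = S the group B is Z, which merges with Z^(d-1) into Z^d. *)
Lemma prod_row_regroup (T : zmodType) (k : nat) :
  exists f : {additive ((int * 'rV[T]_k) * 'rV[int]_k)%type ->
                       ('rV[T]_k * 'rV[int]_k.+1)%type}, bijective f.
Proof.
have [|f fE] := @additive_exists ((int * 'rV[T]_k) * 'rV[int]_k)%type
  ('rV[T]_k * 'rV[int]_(1 + k))%type (fun x => (x.1.2, row_mx x.1.1%:M x.2)).
  move=> [[x t] z] [[x' t'] z'] /=; congr (_, _).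
  transitivity (row_mx x%:M z - row_mx x'%:M z') => //.
  by rewrite opp_row_mx add_row_mx raddfB.
exists f; exists (fun y : 'rV[T]_k * 'rV[int]_(1 + k) =>
  ((lsubmx y.2 0 0, y.1), rsubmx y.2)).
  by move=> [[x t] z]; rewrite fE /= row_mxKl row_mxKr mxE eqxx.
by move=> [t z]; rewrite fE /= -mx11_scalar hsubmxK.
Qed.

Lemma card_eq_finType (G : Type) (A : finType) (f : G -> A) :
  bijective f -> ([set: G] #= `I_#|A|)%card.
Proof.
move=> [g fK gK]; apply/card_set_bijP; exists (fun x => enum_rank (f x) : nat).
split=> [x _|x y _ _|i /= lt_iA] /=; first exact: ltn_ord.
  by move=> /val_inj/enum_rank_inj/(can_inj fK).
exists (g (enum_val (Ordinal lt_iA))) => //.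
by rewrite gK enum_valK.
Qed.

HB.instance Definition _ (A B : finZmodType) := Finite.on (A * B)%type.

Theorem corollary3p2 (n r s : nat)
    (hn : (1 <= n)%N) (hr : (1 <= r)%N) (hs : (1 <= s)%N) :
  let d := gcdn (gcdn r n) s in
  let R := (r %/ d)%N in
  let N := (n %/ d)%N in
  let S := (s %/ d)%N in
  (s <> r ->
    exists m : nat,
      ([set: abelianization (fib_group R N S)] #= `I_m)%card /\
      exists A0 : finZmodType,
        (#|A0|%:R = m%:R ^+ d / `|S%:R - R%:R| ^+ d.-1 :> rat) /\
        exists f : {additive abelianization (fib_group r n s) ->
                             (A0 * 'rV[int]_d.-1)%type},
          bijective f) /\
  (s = r ->
    exists A0 : finZmodType,
      #|A0| = (N ^ d.-1)%N /\
      exists f : {additive abelianization (fib_group r n s) ->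
                           (A0 * 'rV[int]_d)%type},
        bijective f).
Proof.
move=> d R N S.
have d_gt0 : (0 < d)%N by rewrite !gcdn_gt0 hr.
have rE : r = (d * R)%N.
  by rewrite mulnC divnK// (dvdn_trans (dvdn_gcdl _ _))// dvdn_gcdl.
have nE : n = (d * N)%N.
  by rewrite mulnC divnK// (dvdn_trans (dvdn_gcdl _ _))// dvdn_gcdr.
have sE : s = (d * S)%N by rewrite mulnC divnK// dvdn_gcdr.
have N_gt0 : (0 < N)%N by move: hn; rewrite nE muln_gt0 => /andP[].
have coRNS : gcdn (gcdn R N) S = 1%N.
  by apply/eqP; rewrite -(eqn_pmul2l d_gt0) muln1 !muln_gcdr -rE -nE -sE.
have [f [fS fK]] := fib_abelianization r s hn.
pose Nm : {poly int} := \sum_(j < N) 'X^j.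
have dE : d = d.-1.+1 by rewrite prednK.
(* The ideal (f, X^n - 1) in the form of [section_decomposition], with d written as a successor. *)
pose J := in_ideal ((fib_poly R S \Po 'X^(d.-1.+1)) * \sum_(i < d.-1.+1) 'X^i)
                   ((('X - 1) * Nm) \Po 'X^(d.-1.+1)).
have fP : surjection_with_kernel J f.
  split=> // p; rewrite fK /J -fib_poly_comp// -dE -rE -sE /Nm -subrX1.
  by rewrite comp_polyB comp_Xn_poly -polyC1 comp_polyC -exprM -nE.
split=> [neq_sr|eq_sr].
  have neqRS : R <> S by move=> eRS; apply: neq_sr; rewrite rE sE eRS.
  have [B [T [pB [pT [pBP pTP cardB]]]]] := finite_quotients N_gt0 coRNS neqRS.
  have [f1 f1P] := fib_abelianization R S N_gt0.
  have [h h_bij] := first_isomorphism f1P pBP.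
  exists #|B|; split; first exact: card_eq_finType h_bij.
  (* With e = |R - S| and |B| = |T| e, the order |B| |T|^(d-1) equals |B|^d / e^(d-1). *)
  exists (B * 'rV[T]_(d.-1))%type; split.
    rewrite card_prod card_mx mul1n natrM natrX cardB natrM [in RHS]dE exprS.
    have -> : `|S%:R - R%:R| = `|R%:Z - S%:Z|%N%:R :> rat.
      by rewrite distrC natr_absz intr_norm rmorphB.
    have e_neq0 : `|R%:Z - S%:Z|%N%:R ^+ d.-1 != 0 :> rat.
      by rewrite expf_neq0// pnatr_eq0; lia.
    by rewrite [in RHS]exprMn mulrA mulfK.
  rewrite subrX1 in pBP.
  have [g gP] := section_decomposition d.-1 pBP pTP.
  exact: first_isomorphism fP gP.
have eqRS : R = S by rewrite /R /S eq_sr.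
have [[pB pBP] [T [pT [pTP cardT]]]] := equal_quotients N_gt0 coRNS eqRS.
rewrite subrX1 in pBP.
have [g gP] := section_decomposition d.-1 pBP pTP.
have [reg reg_bij] := prod_row_regroup T d.-1.
have [g' g'P] := surjection_with_kernel_bij gP reg_bij.
exists ('rV[T]_(d.-1)); split; first by rewrite card_mx mul1n cardT.
by have := first_isomorphism fP g'P; rewrite -dE.
Qed.
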